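(* Let $0<M<N$ be integers, let $a_{ij}\in\mathbb{R}$ ($i=1,\dots,M$, $j=1,\dots,N$), $g_i\in\mathbb{R}$ ($i=1,\dots,M$) and $u^b_i\in\mathbb{R}$ ($i=M+1,\dots,N$) be given, and assume that $$\sum_{i,j=1}^M v_i\,a_{ij}\,v_j>0\qquad\forall\,(v_1,\dots,v_M)\in\mathbb{R}^M\setminus\{0\}.$$ For every $\mathrm{U}\in\mathbb{R}^N$ let $\mathbb{B}(\mathrm{U})=(b_{ij}(\mathrm{U}))_{i,j=1}^N$ be a real matrix such that, for all $\mathrm{U}\in\mathbb{R}^N$, $b_{ij}(\mathrm{U})=b_{ji}(\mathrm{U})$ for $i,j=1,\dots,N$; $b_{ij}(\mathrm{U})\le 0$ for $i,j=1,\dots,N$, $i\ne j$; and $\sum_{j=1}^N b_{ij}(\mathrm{U})=0$ for $i=1,\dots,N$. Assume (A1): for any $i\in\{1,\dots,M\}$ and $j\in\{1,\dots,N\}$, the function $\mathrm{U}=(u_1,\dots,u_N)\mapsto b_{ij}(\mathrm{U})(u_j-u_i)$ is continuous on $\mathbb{R}^N$, and for any $i\in\{1,\dots,M\}$ and $j\in\{M+1,\dots,N\}$, the function $\mathrm{U}\mapsto b_{ij}(\mathrm{U})$ is bounded on $\mathbb{R}^N$. Then there exists $\mathrm{U}=(u_1,\dots,u_N)\in\mathbb{R}^N$ such that $$\sum_{j=1}^N (a_{ij}+b_{ij}(\mathrm{U}))\,u_j=g_i,\quad i=1,\dots,M,\qquad u_i=u^b_i,\quad i=M+1,\dots,N.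$$
   Context: The matrix $(a_{ij})_{i,j=1}^M$ is not assumed symmetric. The functions $b_{ij}$ themselves are not assumed continuous. *)

(* Defs.v *)
From HB Require Import structures.
From mathcomp Require Export all_boot all_order all_algebra.
From mathcomp Require Export all_classical all_reals all_analysis.
Export numFieldNormedType.Exports.

Set Implicit Arguments.
Unset Strict Implicit.
Unset Printing Implicit Defensive.

(* Indices are 0-based: the unknowns u_1, ..., u_M are those of index i < M,
   the prescribed values u_(M+1), ..., u_N those of index i with M <= i < N. *)
Definition free_index (M N : nat) (ltMN : (M < N)%N) : 'I_M -> 'I_N :=
  widen_ord (ltnW ltMN).

Definition boundary_index (M N : nat) : Type := {i : 'I_N | (M <= i)%N}.

(* Main.v *)
Require Import Defs.
From mathcomp Require Import ring.
Set Implicit Arguments.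
Unset Strict Implicit.
Unset Printing Implicit Defensive.
Import Order.TTheory GRing.Theory Num.Theory.
Local Open Scope classical_set_scope.
Local Open Scope ring_scope.

(* In the unknowns [v = (u_1, ..., u_M)] the system reads [F v = 0]. Since the
   row sums vanish, [b_ij] enters only through [b_ij (u_j - u_i)], so [F] is
   continuous; and [F v . v] is the positive definite form of [a], plus
   [- 1/2 sum b_ij (u_i - u_j)^2 >= 0] over the free [i], [j], plus
   [- sum b_ij u_i^2 >= 0] over the free [i] and the boundary [j], plus terms
   which are at most linear in [v]. So [F v . v > 0] for [v] large, and [F] has a
   zero because it solves a variational inequality on every cube.

   The variational inequality is the limit of a cubical Sperner lemma (Kuhn). In
   dimension [n], take 0/1 labels [l_1, ..., l_n] on a grid, with [l_k = 0] where
   [x_k = 0] and [l_k = 1] where [x_k = p]. The sum over the grid of the cup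
   product of the mod 2 coboundaries [d l_1, ..., d l_n] is a boundary term:
   only the face [x_1 = p] contributes, so by induction on [n] it is 1. Hence on
   some cell every label takes both values. *)

(** * Arithmetic modulo 2 *)

Lemma F2_addrr (x : 'F_2) : x + x = 0.
Proof. by apply: addrr_pchar2; exact: pchar_Fp. Qed.

Lemma F2_addr_eq0 (x y : 'F_2) : (x + y == 0) = (x == y).
Proof. by rewrite -[in RHS]subr_eq0 -[- y]addr0 -(F2_addrr y) addKr. Qed.

(** The terms at [(i, j)] and [(j, i)] are equal, so they cancel modulo 2; the diagonal is left out
    of the sum. *)
Lemma F2_sum_sym (n : nat) (S : {set 'I_n}) (G : 'I_n -> 'I_n -> 'F_2) :
  (forall i j, G i j = G j i) -> \sum_(j in S) \sum_(i in S :\ j) G i j = 0.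
Proof.
move=> G_sym.
have split_lt (j : 'I_n) : \sum_(i in S :\ j) G i j =
    \sum_(i in S | (i < j)%N) G i j + \sum_(i in S | (j < i)%N) G i j.
  rewrite (bigID (fun i : 'I_n => (i < j)%N)) /=.
  congr (_ + _); apply: eq_bigl => i; rewrite !inE -val_eqE /=;
    by case: ltngtP; rewrite ?andbT ?andbF.
rewrite (eq_bigr _ (fun j _ => split_lt j)) big_split /=.
rewrite [X in _ + X](exchange_big_dep (mem S)) /=; last by move=> i j _ /andP[].
rewrite -[RHS](F2_addrr (\sum_(j in S) \sum_(i in S | (i < j)%N) G i j)).
congr (_ + _); apply: eq_bigr => j jS; apply: eq_big => [i|i _].
  by rewrite jS.
exact: G_sym.
Qed.

(** * Cup products of coboundaries on the integer grid *)

Section Cochains.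
Variable n : nat.
Local Notation point := ('I_n -> nat).
Implicit Types (x y : point) (i j k : 'I_n) (f h : point -> 'F_2).
Implicit Types (s : seq 'I_n) (S : {set 'I_n}) (L : 'I_n -> point -> 'F_2).

Definition incr_coord j x : point := fun i => (x i + (i == j))%N.

Definition set_coord j t x : point := fun i => if i == j then t else x i.

Definition coord_diff j f x : 'F_2 := f (incr_coord j x) + f x.

(* [cup L s S x] is the sum, over the orderings of the directions [S], of the
   value of the cup product of the coboundaries of the labels [L k], [k] in [s],
   on the simplex with first vertex [x] which increments the coordinates in this
   order. It is defined as the coboundary of the cup product of the first label
   with the coboundaries of the others; [cup_cons] gives the product form. *)
Fixpoint cup L s S x : 'F_2 :=
  if s is k :: s' then
    \sum_(j in S) coord_diff j (fun y => L k y * cup L s' (S :\ j) y) x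
  else 1.

Lemma incr_coordC i j x :
  incr_coord i (incr_coord j x) = incr_coord j (incr_coord i x).
Proof. by apply/funext => k; rewrite /incr_coord addnAC. Qed.

Lemma coord_diffC i j f x :
  coord_diff i (coord_diff j f) x = coord_diff j (coord_diff i f) x.
Proof. by rewrite /coord_diff incr_coordC addrACA. Qed.

Lemma coord_diff_sum j S (G : 'I_n -> point -> 'F_2) x :
  coord_diff j (fun y => \sum_(i in S) G i y) x =
  \sum_(i in S) coord_diff j (G i) x.
Proof. by rewrite /coord_diff big_split. Qed.

(** This is [d d = 0]: mixed second differences do not depend on the order of the two directions, so
    they cancel in pairs. *)
Lemma cup_closed L s S x : \sum_(j in S) coord_diff j (cup L s (S :\ j)) x = 0.
Proof.
case: s => [|k s] /=.
  by rewrite big1 // => j _; rewrite /coord_diff F2_addrr.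
rewrite (eq_bigr _ (fun j _ => coord_diff_sum j _ _ x)).
apply: (@F2_sum_sym n S (fun i j => coord_diff j (coord_diff i
  (fun y => L k y * cup L s (S :\ j :\ i) y)) x)) => i j.
rewrite coord_diffC; congr (coord_diff _ (coord_diff _ _) _); apply/funext => y.
by congr (_ * cup _ _ _ _); apply/setP => l; rewrite !inE andbCA.
Qed.

(** By the Leibniz rule, the difference of a product splits into this sum and a multiple of the
    coboundary that [cup_closed] kills. *)
Lemma cup_cons L k s S x :
  cup L (k :: s) S x =
  \sum_(j in S) coord_diff j (L k) x * cup L s (S :\ j) (incr_coord j x).
Proof.
transitivity (
    \sum_(j in S) coord_diff j (L k) x * cup L s (S :\ j) (incr_coord j x) +
    L k x * \sum_(j in S) coord_diff j (cup L s (S :\ j)) x); last first.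
  by rewrite cup_closed mulr0 addr0.
rewrite mulr_sumr -big_split /=; apply: eq_bigr => j _.
rewrite /coord_diff mulrDl mulrDr -addrA; congr (_ + _).
by rewrite addrA F2_addrr add0r.
Qed.

(** A nonzero summand of [cup_cons] selects a monotone path from [x] along which each label of [s]
    changes on some edge. The last two clauses locate that edge: it moves only in directions of [S]
    and stays in the unit cell at [x]. *)
Lemma cup_neq0 L s S x : cup L s S x != 0 -> forall k, k \in s ->
  exists (y : point) i, [/\ i \in S, L k (incr_coord i y) != L k y,
    forall j, j \notin S -> y j = x j &
    forall j, (x j <= y j)%N /\ (incr_coord i y j <= (x j).+1)%N].
Proof.
elim: s S x => [//|l s IHs] S x cup_n0 k.
have {cup_n0}[j jS] : exists2 j, j \in S &
    coord_diff j (L l) x * cup L s (S :\ j) (incr_coord j x) != 0.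
  apply/exists_inP; apply: contraNT cup_n0 => /exists_inPn all0.
  by rewrite cup_cons big1 // => j /all0 /negPn/eqP.
rewrite mulf_eq0 negb_or => /andP[Dl cup_n0].
rewrite inE => /predU1P[->|ks].
  exists x, j; split => //; first by rewrite -F2_addr_eq0.
  by move=> i; rewrite /incr_coord; case: eqP; rewrite ?addn0 ?addn1.
have [y [i [iS Lk yx xy]]] := IHs _ _ cup_n0 k ks.
exists y, i; split => // [|l' l'S|l'].
- by move: iS; rewrite inE => /andP[].
- rewrite yx ?inE ?(negPf l'S) ?andbF // /incr_coord.
  by case: eqP l'S => [->|_ _]; rewrite ?jS ?addn0.
- have [le1 le2] := xy l'; move: le1 le2; rewrite {1 3}/incr_coord.
  case: eqP => [->|_]; last by rewrite addn0.
  (* The first step has used direction [j], which is absent from [S :\ j], so coordinate [j] stays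
     at [(x j).+1] afterwards. *)
  rewrite addn1 => /ltnW lexy; split => //.
  rewrite (_ : incr_coord i y j = y j); last first.
    by rewrite /incr_coord; case: eqP iS => [->|_ _]; rewrite ?inE ?eqxx ?addn0.
  by rewrite yx ?inE ?eqxx // /incr_coord eqxx addn1.
Qed.

(** * Summation over a box of the grid *)

Section Box.
Variable p : nat.

Fixpoint box_sum s f : point -> 'F_2 :=
  if s is k :: s' then
    box_sum s' (fun x => \sum_(t < p) f (set_coord k t x))
  else f.

Lemma box_sum0 s f x : (forall y, f y = 0) -> box_sum s f x = 0.
Proof.
elim: s f => [|k s IHs] f f0 /=; first exact: f0.
by apply: IHs => y; rewrite big1.
Qed.

Lemma box_sum_sum s (I : finType) (P : pred I) (G : I -> point -> 'F_2) x :
  box_sum s (fun y => \sum_(i | P i) G i y) x =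
  \sum_(i | P i) box_sum s (G i) x.
Proof.
elim: s G => [//|k s IHs] G /=; rewrite -IHs.
by congr (box_sum _ _ _); apply/funext => y; rewrite exchange_big.
Qed.

Lemma box_sum_eq s f h x :
  (forall y, (forall i, i \notin s -> y i = x i) -> f y = h y) ->
  box_sum s f x = box_sum s h x.
Proof.
elim: s f h => [|k s IHs] f h fh /=; first exact: fh.
apply: IHs => y yx; apply: eq_bigr => t _; apply: fh => i.
rewrite inE negb_or /set_coord => /andP[/negPf->]; exact: yx.
Qed.

Lemma telescope_coord_diff j f x :
  \sum_(t < p) coord_diff j f (set_coord j t x) =
  f (set_coord j p x) + f (set_coord j 0%N x).
Proof.
have -> : \sum_(t < p) coord_diff j f (set_coord j t x) =
    \sum_(0 <= t < p) (f (set_coord j t.+1 x) - f (set_coord j t x)).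
  rewrite big_mkord; apply: eq_bigr => t _; rewrite /coord_diff.
  congr (f _ + _); last by apply/eqP; rewrite -addr_eq0 F2_addrr.
  apply/funext => i; rewrite /incr_coord /set_coord.
  by case: eqP; rewrite ?addn1 ?addn0.
rewrite telescope_sumr //; congr (_ + _).
by apply/eqP; rewrite eq_sym -addr_eq0 F2_addrr.
Qed.

(** Sums in the other directions commute with the difference in direction [j]; the sum in direction
    [j] telescopes to two faces where [f] vanishes. *)
Lemma box_sum_coord_diff0 s j f x : j \in s ->
  (forall y, y j = 0%N \/ y j = p -> f y = 0) ->
  box_sum s (coord_diff j f) x = 0.
Proof.
elim: s f => [//|k s IHs] f js f0 /=; have [kj|kj] := eqVneq j k.
  apply: box_sum0 => y; rewrite -kj telescope_coord_diff !f0 ?addr0 //.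
  - by left; rewrite /set_coord eqxx.
  - by right; rewrite /set_coord eqxx.
rewrite (_ : (fun y => _) =
    coord_diff j (fun y => \sum_(t < p) f (set_coord k t y))).
  apply: IHs => [|y y0]; first by move: js; rewrite inE (negPf kj).
  by apply: big1 => t _; apply: f0; rewrite /set_coord (negPf kj).
apply/funext => y; rewrite /coord_diff big_split; congr (_ + _).
apply: eq_bigr => t _; congr f; apply/funext => i; rewrite /incr_coord /set_coord.
by case: eqP => // ->; rewrite eq_sym (negPf kj) addn0.
Qed.

Lemma box_sum_neq0 s f x : box_sum s f x != 0 ->
  exists2 y, (forall i, i \in s -> (y i < p)%N) & f y != 0.
Proof.
elim: s f => [|k s IHs] f /=; first by exists x.
move=> /IHs[y yp sum_n0].
have [t ft] : exists t : 'I_p, f (set_coord k t y) != 0.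
  apply/existsP; apply: contraNT sum_n0 => /existsPn all0.
  by rewrite big1 // => t _; apply/eqP; have := all0 t; rewrite negbK.
exists (set_coord k t y) => // i; rewrite inE /set_coord.
by case: eqP => //= _ /yp.
Qed.

(** In the coboundary form of [cup], direction [k] telescopes to the faces [x_k = p], where [L k] is
    1, and [x_k = 0], where it is 0. The base point [fun=> p] places the remaining sum on the first
    face, as the induction hypothesis requires. *)
Lemma box_sum_cup s L : uniq s ->
  (forall k x, x k = 0%N -> L k x = 0) -> (forall k x, x k = p -> L k x = 1) ->
  box_sum s (cup L s [set k in s]) (fun=> p) = 1.
Proof.
move=> + L0 Lp; elim: s => [//|k s IHs] /andP[ks us]; rewrite -[RHS](IHs us).
rewrite [cup _ _ _](_ : _ = fun x => \sum_(j in [set i in k :: s])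
  coord_diff j (fun y => L k y * cup L s ([set i in k :: s] :\ j) y) x) //.
rewrite box_sum_sum (bigD1 k) /=; last by rewrite !inE eqxx.
rewrite [X in _ + X]big1 ?addr0.
  rewrite (_ : [set i in k :: s] :\ k = [set i in s]); last first.
    by apply/setP => i; rewrite !inE; case: eqP => // ->; rewrite (negPf ks).
  apply: box_sum_eq => y yp; rewrite telescope_coord_diff.
  rewrite Lp ?L0 /set_coord ?eqxx // mul1r mul0r addr0; congr cup.
  by apply/funext => i; case: eqP => // ->; rewrite yp.
(* For [j != k], a nonzero [cup] on a face [y j = 0] or [y j = p] would make [L j] change on an edge
   inside that face, where [L j] is constant. *)
move=> j /andP[js jk]; apply: (@box_sum_coord_diff0 (k :: s)).
  by move: js; rewrite inE.
move=> y y0; apply/eqP; apply: contraT; rewrite mulf_eq0 negb_or.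
have {jk}js : j \in s by move: js; rewrite !inE (negPf jk).
case/andP => _ /cup_neq0/(_ j js)[z [i [iS + zy _]]].
have ij : i != j by move: iS; rewrite inE => /andP[]; rewrite inE.
have zj : incr_coord i z j = z j by rewrite /incr_coord eq_sym (negPf ij) addn0.
have zyj : z j = y j by rewrite zy // !inE eqxx.
by case: y0 => y0; [rewrite !L0|rewrite !Lp]; rewrite ?eqxx ?zj ?zyj.
Qed.

End Box.

(** The sum over the box is 1, so [cup] is nonzero at some cell, and [cup_neq0] finds an edge of
    that cell on which a given label changes. *)
Lemma kuhn (p : nat) (l : 'I_n -> point -> bool) :
  (forall k x, x k = 0%N -> l k x = false) ->
  (forall k x, x k = p -> l k x = true) ->
  exists2 x : point, forall i, (x i < p)%N &
  forall k, exists y z : point,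
    [/\ l k y = false, l k z = true,
      forall i, (x i <= y i <= (x i).+1)%N &
      forall i, (x i <= z i <= (x i).+1)%N].
Proof.
move=> l0 lp; pose L k x : 'F_2 := (l k x)%:R.
have : box_sum p (enum 'I_n) (cup L (enum 'I_n) [set k in enum 'I_n])
    (fun=> p) != 0.
  by rewrite box_sum_cup ?oner_eq0 ?enum_uniq // => k x;
    by rewrite /L; do [move/l0|move/lp] => ->.
case/box_sum_neq0 => x xp cup_n0; exists x => [i|k].
  by apply: xp; rewrite mem_enum.
have [|y [i [_ Lk _ xy]]] := cup_neq0 cup_n0 (k := k); first by rewrite mem_enum.
have yx j : (x j <= y j <= (x j).+1)%N.
  have [-> le_y] := xy j; apply: leq_trans le_y; exact: leq_addr.
have zx j : (x j <= incr_coord i y j <= (x j).+1)%N.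
  have [le_y ->] := xy j; rewrite andbT (leq_trans le_y) //; exact: leq_addr.
move: Lk; rewrite /L; case Ey: (l k y); case Ez: (l k (incr_coord i y)) => // _.
- by exists (incr_coord i y), y.
- by exists y, (incr_coord i y).
Qed.

End Cochains.

(** * A variational inequality on the cube *)

Section Cube.
Variables (R : realType) (n : nat) (r : R) (F : 'I_n -> 'rV[R]_n -> R).
Hypothesis r_gt0 : 0 < r.

Definition cube : set 'rV[R]_n := [set v | forall i, v ord0 i \in `[- r, r]].

Lemma cube_compact : compact cube.
Proof.
apply: (@rV_compact _ _ (fun=> `[- r, r]%classic)) => _.
exact: segment_compact.
Qed.

Lemma approx_cell (q : nat) : exists2 u : 'rV[R]_n, cube u &
  forall k, exists y z : 'rV[R]_n,
    [/\ y 0 k = - r \/ F k y < 0, z 0 k = r \/ 0 <= F k z,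
      forall i, `|u 0 i - y 0 i| <= 2 * r / q.+1%:R &
      forall i, `|u 0 i - z 0 i| <= 2 * r / q.+1%:R].
Proof.
set d := 2 * r / q.+1%:R.
have d_ge0 : 0 <= d by rewrite divr_ge0 // mulr_ge0 // ltW.
have dq : q.+1%:R * d = 2 * r by rewrite mulrC divfK // pnatr_eq0.
pose grid (x : 'I_n -> nat) : 'rV[R]_n := \row_i ((x i)%:R * d - r).
have grid_le x y : (forall i, (x i <= y i <= (x i).+1)%N) ->
    forall i, `|grid x 0 i - grid y 0 i| <= d.
  move=> xy i; rewrite !mxE opprB addrA subrK -mulrBl normrM (ger0_norm d_ge0).
  rewrite -[leRHS]mul1r ler_wpM2r // distrC.
  have /andP[le1 le2] := xy i.
  by rewrite -natrB // ger0_norm ?ler0n // lern1 leq_subLR addn1.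
(* The label is the sign of [F k], overridden on the two faces normal to direction [k] to meet the
   boundary conditions of [kuhn]. *)
have [||x xq cell] := @kuhn n q.+1 (fun k x =>
    (x k != 0%N) && ((x k == q.+1) || (0 <= F k (grid x)))).
- by move=> k x ->; rewrite eqxx.
- by move=> k x ->; rewrite eqxx.
exists (grid x) => [i|k].
  rewrite mxE in_itv /= lerBrDr addNr mulr_ge0 //= lerBlDr.
  by rewrite -mulr2n -(mulr_natl r) -dq ler_wpM2r // ler_nat ltnW.
have [y [z [ly lz /grid_le xy /grid_le xz]]] := cell k.
exists (grid y), (grid z); split => //.
- move: ly; case: eqP => [y0 _|_ /= /norP[_]]; last by rewrite -ltNge; right.
  by left; rewrite mxE y0 mul0r add0r.
- move/andP: lz => [_ /predU1P[zq|]]; last by right.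
  by left; rewrite mxE zq dq mulr_natl mulr2n addrK.
Qed.

(* The Hartman-Stampacchia variational inequality, read coordinatewise. *)
Lemma cube_variational : (forall k, continuous (F k)) ->
  exists2 x : 'rV[R]_n, cube x &
    forall k, (x 0 k = - r \/ F k x <= 0) /\ (x 0 k = r \/ 0 <= F k x).
Proof.
move=> F_cont.
have [u u_cube u_cell] : exists2 u : nat -> 'rV[R]_n, (forall q, cube (u q)) &
  forall q k, exists y z : 'rV[R]_n,
    [/\ y 0 k = - r \/ F k y < 0, z 0 k = r \/ 0 <= F k z,
      forall i, `|u q 0 i - y 0 i| <= 2 * r / q.+1%:R &
      forall i, `|u q 0 i - z 0 i| <= 2 * r / q.+1%:R].
  pose u q := s2val (cid2 (approx_cell q)).
  exists u => q; rewrite /u; by case: cid2.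
have [x [x_cube x_cluster]] : cube `&` cluster (u @ \oo) !=set0.
  apply: cube_compact; exists 0%N => // q _; exact: u_cube.
exists x => // k.
have near_neq c : x 0 k != c -> nbhs x [set y : 'rV[R]_n | y 0 k != c].
  move=> xc; apply: (@coord_continuous R 1 n 0 k x [set t | t != c]).
  by apply: open_nbhs_nbhs; split => //; exact: open_neq.
(* The cells shrink and their base corners cluster at [x], so every neighbourhood of [x] contains
   both witnesses of some cell. The radius is halved between the corner and the mesh. *)
have near_cell (A : set 'rV[R]_n) : nbhs x A -> exists y z, [/\ A y, A z,
    y 0 k = - r \/ F k y < 0 & z 0 k = r \/ 0 <= F k z].
  move=> /nbhs_ballP[e /= e_gt0 sub_A].
  have [q [qe ux]] : exists q, 2 * r / q.+1%:R < e / 2 /\ ball x (e / 2) (u q).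
    have [v [[q qe <-] ux]] : [set u q | q in [set q | 2 * r / q.+1%:R < e / 2]]
        `&` ball x (e / 2) !=set0.
      apply: x_cluster; last by apply: nbhsx_ballx; rewrite divr_gt0.
      have e2 : 0 < e / 2 / (2 * r) by rewrite !divr_gt0 // mulr_gt0.
      apply: filterS (near_infty_natSinv_lt (PosNum e2)) => q qe /=.
      exists q => //=; rewrite mulrC -ltr_pdivlMr ?mulr_gt0 //.
    by exists q.
  have [y [z [y_neg z_pos uy uz]]] := u_cell q k.
  have in_A (w : 'rV[R]_n) :
      (forall i, `|u q 0 i - w 0 i| <= 2 * r / q.+1%:R) -> A w.
    move=> uw; apply: sub_A; rewrite (splitr e); apply: ball_triangle ux _.
    split => [|i j]; first by rewrite divr_gt0.
    by rewrite ord1; apply: le_lt_trans (uw j) qe.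
  by exists y, z; split => //; apply: in_A.
split.
- have [xr|xr] := eqVneq (x 0 k) (- r); first by left.
  right; rewrite leNgt; apply/negP => Fx.
  (* Both strict conditions persist near [x], which contradicts the witness [y]. *)
  have [|y [_ [[yr Fy] _ y_neg _]]] :=
      near_cell [set y : 'rV[R]_n | y 0 k != - r /\ 0 < F k y :> R].
    by apply: filterI; [exact: near_neq|exact: (cvgr_gt (F k x) (F_cont k x))].
  case: y_neg => [y_r|]; first by rewrite y_r eqxx in yr.
  by rewrite ltNge ltW.
- have [xr|xr] := eqVneq (x 0 k) r; first by left.
  right; rewrite leNgt; apply/negP => Fx.
  have [|_ [z [_ [zr Fz] _ z_pos]]] :=
      near_cell [set y : 'rV[R]_n | y 0 k != r /\ F k y < 0].
    by apply: filterI; [exact: near_neq|exact: (cvgr_lt (F k x) (F_cont k x))].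
  case: z_pos => [z_r|]; first by rewrite z_r eqxx in zr.
  by rewrite leNgt Fz.
Qed.

End Cube.

(** * Zeros of coercive fields and estimates for quadratic forms *)

Lemma entry_le_mx_norm (R : realType) (m n : nat) (x : 'M[R]_(m, n)) i j :
  `|x i j| <= `|x|.
Proof.
rewrite [leRHS]/Num.norm /= mx_normrE.
by apply/bigmax_geP; right => /=; exists (i, j).
Qed.

(** At a solution of the variational inequality every [F i x * x 0 i] is at most 0, so coercivity
    gives norm less than [r]. The norm is the maximum norm, hence no face constraint is active and
    the inequalities become equations. *)
Lemma coercive_zero (R : realType) (n : nat) (F : 'I_n -> 'rV[R]_n -> R) (r : R) :
  0 < r -> (forall k, continuous (F k)) ->
  (forall v : 'rV[R]_n, r <= `|v| -> 0 < \sum_i F i v * v 0 i) ->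
  exists x, forall i, F i x = 0.
Proof.
move=> r_gt0 F_cont F_coer.
have [x x_cube Fx] := cube_variational r_gt0 F_cont; exists x => k.
have x_small : `|x| < r.
  rewrite ltNge; apply/negP => /F_coer; rewrite ltNge => /negP; apply.
  apply: sumr_le0 => i _; have [lo hi] := Fx i.
  have xi_lo : x 0 i = - r -> x 0 i != r.
    by move=> ->; rewrite lt_eqF // gtrN.
  case: hi => [xr|F_ge0].
    case: lo => [/xi_lo|F_le0]; first by rewrite xr eqxx.
    by rewrite mulr_le0_ge0 // xr ltW.
  case: lo => [->|F_le0]; first by rewrite mulr_ge0_le0 // oppr_le0 ltW.
  by rewrite (_ : F i x = 0) ?mul0r //; apply/eqP; rewrite eq_le F_le0.
have xk : `|x 0 k| < r := le_lt_trans (entry_le_mx_norm x 0 k) x_small.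
have [lo hi] := Fx k; apply/eqP; rewrite eq_le; apply/andP; split.
- by case: lo => // xr; move: xk; rewrite xr normrN gtr0_norm // ltxx.
- by case: hi => // xr; move: xk; rewrite xr gtr0_norm // ltxx.
Qed.

(** By homogeneity [alpha] can be the minimum of [q] on the unit sphere, which is compact. *)
Lemma quadratic_coercive (R : realType) (n : nat) (q : 'rV[R]_n -> R) :
  continuous q -> (forall t v, q (t *: v) = t ^+ 2 * q v) ->
  (forall v, v != 0 -> 0 < q v) ->
  exists2 alpha, 0 < alpha & forall v, alpha * `|v| ^+ 2 <= q v.
Proof.
move=> q_cont q_hom q_pos.
have q0 : q 0 = 0 by rewrite -(scale0r 0) q_hom expr0n mul0r.
(* The sphere is empty if there is no nonzero vector; any constant then works. *)
have [[w w0]|all0] := pselect (exists v : 'rV[R]_n, v != 0); last first.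
  exists 1 => // v; have [->|v0] := eqVneq v 0; last by case: all0; exists v.
  by rewrite normr0 expr0n mulr0 q0.
pose sphere := [set v : 'rV[R]_n | `|v| = 1].
have unit_sphere v : v != 0 -> sphere (`|v|^-1 *: v).
  move=> v0; rewrite /sphere /= normrZ normfV normr_id mulVf ?normr_eq0 //.
have sphere_compact : compact sphere.
  apply: bounded_closed_compact.
    exists 1; split => // M M1 v /= ->; exact: ltW.
  rewrite (_ : sphere = Num.norm @^-1` [set 1]) //.
  apply: closed_comp => [? _|]; [exact: norm_continuous|exact: closed_eq].
have [|c /set_mem c_sphere c_min] := EVT_min_rV _ sphere_compact
    (continuous_subspaceT q_cont).
  by exists (`|w|^-1 *: w); exact: unit_sphere.
exists (q c) => [|v].
  apply: q_pos; apply/eqP => c0.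
  by move: c_sphere; rewrite /sphere /= c0 normr0 => /esym/eqP; rewrite oner_eq0.
have [->|v0] := eqVneq v 0; first by rewrite normr0 expr0n mulr0 q0.
have := c_min _ (mem_set (unit_sphere v v0)); rewrite q_hom exprVn.
by rewrite ler_pdivlMl ?exprn_gt0 ?normr_gt0 // mulrC.
Qed.

(** Adding the sum with [i] and [j] exchanged turns twice the form into a sum of
    [- b i j * (v i - v j) ^+ 2]. *)
Lemma symmetric_form_ge0 (R : realType) (n : nat) (b : 'I_n -> 'I_n -> R)
    (v : 'I_n -> R) :
  (forall i j, b i j = b j i) -> (forall i j, i != j -> b i j <= 0) ->
  0 <= \sum_i \sum_j v i * (b i j * (v j - v i)).
Proof.
move=> b_sym b_neg; rewrite -(pmulrn_lge0 _ (ltn0Sn 1)) mulr2n.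
rewrite [X in X + _]exchange_big -big_split; apply: sumr_ge0 => i _.
rewrite -big_split; apply: sumr_ge0 => j _ /=.
rewrite (_ : _ + _ = - b i j * (v i - v j) ^+ 2).
  have [->|ij] := eqVneq i j; first by rewrite subrr expr0n mulr0.
  by rewrite mulr_ge0 ?sqr_ge0 // oppr_ge0 b_neg.
rewrite b_sym; ring.
Qed.

Lemma continuous_sum (R : realType) (T : topologicalType) (I : Type)
    (s : seq I) (P : pred I) (f : I -> T -> R) :
  (forall i, P i -> continuous (f i)) ->
  continuous (fun x => \sum_(i <- s | P i) f i x).
Proof. by apply: continuous_big; exact: add_continuous. Qed.

(** * Assembling free and prescribed values into one vector *)

Section Glue.
Variables (R : realType) (M N : nat) (ltMN : (M < N)%N).
Variable ub : boundary_index M N -> R.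

(** Totalised, with default 0 at free indices, so that it can appear in filtered sums over
    ['I_N]. *)
Definition boundary_value (i : 'I_N) : R :=
  oapp ub 0 (insub i : option (boundary_index M N)).

Definition glue (v : 'rV[R]_M) : 'cV[R]_N :=
  \col_i oapp (v 0) (boundary_value i) (insub (val i) : option 'I_M).

Lemma glue_free v i : glue v (free_index ltMN i) 0 = v 0 i.
Proof. by rewrite mxE valK. Qed.

Lemma glue_ge v (i : 'I_N) : (M <= i)%N -> glue v i 0 = boundary_value i.
Proof. by move=> Mi; rewrite mxE insubF //= ltnNge Mi. Qed.

Lemma glue_boundary v (i : boundary_index M N) : glue v (sval i) 0 = ub i.
Proof. by rewrite (glue_ge v (valP i)) /boundary_value valK. Qed.

Lemma glue_continuous : continuous glue.
Proof.
move=> v A /nbhs_ballP[e e0 sub_A].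
apply/nbhs_ballP; exists e => //= w [_ vw]; apply: sub_A; split => // i j.
by rewrite !mxE; case: insubP => [k _ _|_]; [exact: vw|exact: ballxx].
Qed.

Lemma sum_free_boundary (f : 'I_N -> R) :
  \sum_j f j = \sum_(j < M) f (free_index ltMN j) + \sum_(j < N | (M <= j)%N) f j.
Proof.
rewrite (bigID (fun j : 'I_N => (j < M)%N)) /= (big_ord_narrow (ltnW ltMN)).
by congr (_ + _); apply: eq_bigl => j; rewrite -leqNgt.
Qed.

End Glue.

(** * Reduction of the nonlinear system to a coercive field *)

Theorem theorem1 (R : realType) (M N : nat) (M_gt0 : (0 < M)%N) (ltMN : (M < N)%N)
    (a : 'M[R]_(M, N)) (g : 'cV[R]_M) (ub : boundary_index M N -> R)
    (a_pos : forall v : 'cV[R]_M, v != 0 ->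
       0 < \sum_(i < M) \sum_(j < M) v i 0 * a i (free_index ltMN j) * v j 0)
    (B : 'cV[R]_N -> 'M[R]_N)
    (B_sym : forall (U : 'cV[R]_N) (i j : 'I_N), B U i j = B U j i)
    (B_offdiag : forall (U : 'cV[R]_N) (i j : 'I_N), i != j -> B U i j <= 0)
    (B_rowsum : forall (U : 'cV[R]_N) (i : 'I_N), \sum_(j < N) B U i j = 0)
    (B_cont : forall (i : 'I_M) (j : 'I_N),
       continuous (fun U : 'cV[R]_N =>
         B U (free_index ltMN i) j * (U j 0 - U (free_index ltMN i) 0)))
    (B_bounded : forall (i : 'I_M) (j : boundary_index M N),
       [bounded B U (free_index ltMN i) (sval j) | U in [set: 'cV[R]_N]]) :
  exists U : 'cV[R]_N,
    (forall i : 'I_M,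
       \sum_(j < N) (a i j + B U (free_index ltMN i) j) * U j 0 = g i 0) /\
    (forall i : boundary_index M N, U (sval i) 0 = ub i).
Proof.
pose e := free_index ltMN; pose bv := boundary_value ub.
pose G i (U : 'cV[R]_N) :=
  \sum_(j < N) (a i j * U j 0 + B U (e i) j * (U j 0 - U (e i) 0)) - g i 0.
have G_cont i : continuous (G i).
  have S_cont : continuous (fun U : 'cV[R]_N =>
      \sum_j (a i j * U j 0 + B U (e i) j * (U j 0 - U (e i) 0))).
    apply: continuous_sum => j _ V.
    exact: (cvgD (cvgMl_tmp (@coord_continuous R N 1 j 0 V)) (B_cont i j V)).
  by move=> U; exact: cvgB (S_cont U) (cvg_cst _).
have GE i U : G i U = \sum_j (a i j + B U (e i) j) * U j 0 - g i 0.
  rewrite /G; congr (_ - _).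
  rewrite [RHS](_ : _ = \sum_j (a i j + B U (e i) j) * U j 0 -
      (\sum_j B U (e i) j) * U (e i) 0); last by rewrite B_rowsum mul0r subr0.
  by rewrite mulr_suml -sumrB; apply: eq_bigr => j _; ring.
pose F i (v : 'rV[R]_M) := G i (glue ub v).
suff [v Fv] : exists v, forall i, F i v = 0.
  exists (glue ub v); split => [i|i]; last exact: glue_boundary.
  by apply/eqP; rewrite -subr_eq0 -GE; apply/eqP/Fv.
pose q (v : 'rV[R]_M) := \sum_i \sum_j v 0 i * a i (e j) * v 0 j.
have [alpha alpha_gt0 q_ge] : exists2 alpha, 0 < alpha &
    forall v, alpha * `|v| ^+ 2 <= q v.
  apply: quadratic_coercive => [|t v|v v0].
  - apply: continuous_sum => i _; apply: continuous_sum => j _ v.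
    exact: (cvgM (cvgMr_tmp (@coord_continuous R 1 M 0 i v))
      (@coord_continuous R 1 M 0 j v)).
  - rewrite mulr_sumr; apply: eq_bigr => i _; rewrite mulr_sumr.
    by apply: eq_bigr => j _; rewrite !mxE; ring.
  - rewrite (_ : q v = \sum_i \sum_j v^T i 0 * a i (e j) * v^T j 0).
      by apply: a_pos; rewrite trmx_eq0.
    by apply: eq_bigr => i _; apply: eq_bigr => j _; rewrite !mxE.
(* The bounds exist only for boundary [j]; the value 0 at free [j] is a placeholder. *)
have [C C_ge] : exists C : 'I_M -> 'I_N -> R, forall i (j : 'I_N), (M <= j)%N ->
    forall U, `|B U (e i) j| <= C i j.
  suff H (ij : 'I_M * 'I_N) : exists c : R, (M <= ij.2)%N ->
      forall U, `|B U (e ij.1) ij.2| <= c.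
    have [C C_ge] := choice H; exists (fun i j => C (i, j)) => i j.
    exact: (C_ge (i, j)).
  case: ij => i j /=; case: (boolP (M <= j)%N) => [Mj|_]; last by exists 0.
  have /pinfty_ex_gt0[c _ Bc] := B_bounded i (exist _ j Mj).
  by exists c => _ U; exact: Bc.
(* These are the coefficients of the part of [F v . v] at most linear in [v]; [K] bounds the sum of
   their absolute values uniformly in [U]. *)
pose c i (U : 'cV[R]_N) :=
  \sum_(j < N | (M <= j)%N) (a i j + B U (e i) j) * bv j - g i 0.
pose K := \sum_(i < M) (\sum_(j < N | (M <= j)%N)
  (`|a i j| + C i j) * `|bv j| + `|g i 0|).
have c_le i U : `|c i U| <= \sum_(j < N | (M <= j)%N)
    (`|a i j| + C i j) * `|bv j| + `|g i 0|.
  apply: le_trans (ler_normB _ _) _; rewrite lerD2r.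
  apply: le_trans (ler_norm_sum _ _ _) _; apply: ler_sum => j Mj.
  rewrite normrM ler_wpM2r //; apply: le_trans (ler_normD _ _) _.
  by rewrite lerD2l C_ge.
have F_ge v : alpha * `|v| ^+ 2 - K * `|v| <= \sum_i F i v * v 0 i.
  set U := glue ub v.
  (* For boundary [j], the factor [u_j - u_i] is split: the prescribed [u_j] joins [c], and [- u_i]
     gives the last square term. *)
  have -> : \sum_i F i v * v 0 i = q v + \sum_i c i U * v 0 i +
      (\sum_i \sum_j v 0 i * (B U (e i) (e j) * (v 0 j - v 0 i)) +
       \sum_i \sum_(j < N | (M <= j)%N) - B U (e i) j * v 0 i ^+ 2).
    rewrite -!big_split; apply: eq_bigr => i _ /=.
    have free_part : (\sum_(j < M) (a i (e j) * U (e j) 0 +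
        B U (e i) (e j) * (U (e j) 0 - U (e i) 0))) * v 0 i =
        \sum_(j < M) v 0 i * a i (e j) * v 0 j +
        \sum_(j < M) v 0 i * (B U (e i) (e j) * (v 0 j - v 0 i)).
      rewrite mulr_suml -big_split; apply: eq_bigr => j _.
      by rewrite !glue_free /=; ring.
    have boundary_part : (\sum_(j < N | (M <= j)%N) (a i j * U j 0 +
        B U (e i) j * (U j 0 - U (e i) 0))) * v 0 i =
        (\sum_(j < N | (M <= j)%N) (a i j + B U (e i) j) * bv j) * v 0 i +
        \sum_(j < N | (M <= j)%N) - B U (e i) j * v 0 i ^+ 2.
      rewrite !mulr_suml -big_split; apply: eq_bigr => j Mj.
      by rewrite glue_free glue_ge //= -/bv; ring.
    rewrite /F /G (sum_free_boundary ltMN) /c !mulrDl free_part boundary_part.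
    ring.
  rewrite -[leLHS]addr0; apply: lerD.
    apply: lerD; first exact: q_ge.
    suff /ler_normlP[] : `|\sum_i c i U * v 0 i| <= K * `|v| by rewrite lerNl.
    apply: le_trans (ler_norm_sum _ _ _) _; rewrite mulr_suml.
    apply: ler_sum => i _; rewrite normrM; apply: ler_pM => //.
    exact: entry_le_mx_norm.
  apply: addr_ge0.
    apply: (@symmetric_form_ge0 _ _ (fun i j => B U (e i) (e j)) (v 0)) => i j //.
    by move=> ij; apply: B_offdiag; rewrite -val_eqE.
  apply: sumr_ge0 => i _; apply: sumr_ge0 => j Mj.
  rewrite mulr_ge0 ?sqr_ge0 // oppr_ge0 B_offdiag // -val_eqE /=.
  by rewrite neq_ltn (leq_trans (ltn_ord i) Mj).
have K_ge0 : 0 <= K.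
  by apply: sumr_ge0 => i _; apply: le_trans (c_le i 0).
(* Beyond this radius [alpha * |v| >= K + 1 > K], which makes the lower bound [F_ge] positive; the
   added 1 also keeps the radius positive when [K = 0]. *)
have r_gt0 : 0 < (K + 1) / alpha by rewrite divr_gt0 // ltr_wpDl.
apply: (@coercive_zero _ _ F _ r_gt0) => [i v|v v_ge].
- exact: continuous_comp (@glue_continuous _ _ _ ub v) (G_cont i _).
- apply: lt_le_trans (F_ge v); have v_gt0 := lt_le_trans r_gt0 v_ge.
  rewrite expr2 mulrA -mulrBl mulr_gt0 // subr_gt0.
  by move: v_ge; rewrite ler_pdivrMr // mulrC; apply: lt_le_trans; rewrite ltrDl.
Qed.
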